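(* Let $G$ be a finitely generated group and $\pi$ a unitary representation of $G$ on a Hilbert space. 1. If $\pi$ is weakly mixing, then for any harmonic cocycle $b$ of $\pi$ (i.e. any $\mu$-harmonic cocycle, where $\mu$ is a symmetric probability measure whose support is a finite symmetric generating set of $G$), $Z^{FC}(G)\subset \ker b\cap\ker\pi_{|\operatorname{Im} b}$. 2. If $\pi$ is ergodic and $G$ is $\mu$-Liouville, where $\mu$ is a symmetric probability measure whose support is a finite generating set of $G$, then for any $\mu$-harmonic cocycle $b$ of $\pi$, $Z(G)\subset\ker b\cap\ker\pi_{|\operatorname{Im} b}$. In particular: 3. If $\pi$ is weakly mixing and there is a non-trivial subgroup $H$ of $Z^{FC}(G)$ such that $\pi_{|H}$ is ergodic, then $\overline{H}^1(G,\pi)=0$. 4. If $\pi$ is ergodic, $G$ is $\mu$-Liouville for some symmetric probability measure $\mu$ whose support is a finite generating set of $G$, and there is a non-trivial subgroup $H$ of $Z(G)$ such that $\pi_{|H}$ is ergodic, then $\overline{H}^1(G,\pi)=0$.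
   Context: $Z(G)$ is the centre of $G$; the FC-centre $Z^{FC}(G)$ is the subgroup of elements of $G$ with finite conjugacy class. A unitary representation is ergodic if it has no non-zero invariant vector, and weakly mixing if it has no non-zero finite-dimensional subrepresentation (equivalently, $m(|\kappa|)=0$ for every coefficient $\kappa(x)=\langle \pi(x)\xi\mid\eta\rangle$, where $m$ is the unique invariant mean on weakly almost periodic functions on $G$). A cocycle of $\pi$ on the Hilbert space $\mathsf{H}$ is a map $b:G\to\mathsf{H}$ with $b(gh)=b(g)+\pi(g)b(h)$ for all $g,h\in G$; coboundaries are the cocycles $g\mapsto\pi(g)\xi-\xi$ with $\xi\in\mathsf{H}$. $Z^1(G,\pi)$ is the space of cocycles, $\overline{B}^1(G,\pi)$ is the closure of the space of coboundaries in $Z^1(G,\pi)$ for pointwise convergence on $G$, and $\overline{H}^1(G,\pi)=Z^1(G,\pi)/\overline{B}^1(G,\pi)$ is the reduced cohomology. For a probability measure $\mu$ with finite generating support $S=S^{-1}$ and $\mu(s)=\mu(s^{-1})$, a cocycle $b$ is $\mu$-harmonic if $\sum_{s\in S}\mu(s)b(s)=0$. $\ker b=\{g\in G: b(g)=0\}$, and $\ker\pi_{|\operatorname{Im}b}=\{g\in G:\pi(g)b(h)=b(h)\text{ for all }h\in G\}$. $G$ is $\mu$-Liouville if every bounded function $f:G\to\mathbb{C}$ with $\sum_{s}\mu(s)f(s^{-1}x)=f(x)$ for all $x\in G$ is constant. *)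

(* Defs.v *)
From HB Require Import structures.
From mathcomp Require Import all_boot all_order all_algebra finmap.
From mathcomp Require Import all_classical all_reals topology normedtype.
From mathcomp Require Import complex.

Set Implicit Arguments.
Unset Strict Implicit.
Unset Printing Implicit Defensive.

Import Order.TTheory GRing.Theory Num.Theory.
Import numFieldNormedType.Exports.

Local Open Scope classical_set_scope.
Local Open Scope ring_scope.
Local Open Scope complex_scope.

(* Complex Hilbert spaces of arbitrary dimension: complete normed spaces over
   R[i] whose norm comes from an inner product. The inner product is linear in
   its first argument. *)
HB.mixin Record isHilbert (R : realType) H of CompleteNormedModule R[i] H := {
  inner : {dot H for Num.conj};
  inner_norm : forall x : H, `|x| ^+ 2 = inner x x
}.

#[short(type="hilbertType")]
HB.structure Definition Hilbert (R : realType) :=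
  {H of CompleteNormedModule R[i] H & isHilbert R H}.

(* Each operator is invertible by rep1 and repM, hence unitary by rep_inner. *)
Record unitary_rep (R : realType) (G : groupType) (H : hilbertType R) :=
  UnitaryRep {
    rep_fun :> G -> {linear H -> H};
    rep1 : forall x, rep_fun 1%g x = x;
    repM : forall g h x, rep_fun (g * h)%g x = rep_fun g (rep_fun h x);
    rep_inner : forall g x y, inner (rep_fun g x) (rep_fun g y) = inner x y
  }.

Section Groups.
Variable G : groupType.
Implicit Types S K : set G.

Definition subgroup K : Prop := group_closed [in K].

Definition generated S : set G := smallest subgroup S.

Definition finitely_generated : Prop :=
  exists2 S : set G, finite_set S & generated S = setT.

Definition centre : set G := [set z | forall g, commute z g].

Definition FC_centre : set G := [set z | finite_set (range (conjg z))].

End Groups.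

Arguments centre : clear implicits.
Arguments FC_centre : clear implicits.

Section Measures.
Variables (R : realType) (G : groupType).

(* A finitely supported measure is represented by its mass function, and
   finsupp mu is its support. *)
Definition symmetric_generating (mu : {fsfun G -> R with 0}) : Prop :=
  [/\ forall s, 0 <= mu s,
      \sum_(s <- finsupp mu) mu s = 1,
      forall s, mu s^-1%g = mu s
    & generated [set` finsupp mu] = setT].

Definition liouville (mu : {fsfun G -> R with 0}) : Prop :=
  forall f : G -> R[i],
    (exists M : R, forall x, `|f x| <= M%:C) ->
    (forall x, \sum_(s <- finsupp mu) (mu s)%:C * f (s^-1 * x)%g = f x) ->
    exists c, forall x, f x = c.

End Measures.

Section Representations.
Variables (R : realType) (G : groupType) (H : hilbertType R).
Variable pi : unitary_rep G H.

(* Ergodicity of the restriction of pi to K. *)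
Definition ergodic_on (K : set G) : Prop :=
  forall x : H, (forall g, K g -> pi g x = x) -> x = 0.

Definition ergodic : Prop := ergodic_on setT.

Definition finite_dimensional (V : set H) : Prop :=
  exists (n : nat) (e : 'I_n -> H),
    V = range (fun c : 'I_n -> R[i] => \sum_(i < n) c i *: e i).

(* Subrepresentations are usually required to be closed; finite-dimensional
   subspaces automatically are. *)
Definition invariant_subspace (V : set H) : Prop :=
  submod_closed [in V] /\ (forall g x, V x -> V (pi g x)).

Definition weakly_mixing : Prop :=
  forall V : set H,
    invariant_subspace V -> finite_dimensional V -> V = [set 0].

Definition cocycle : set {ptws G -> H} :=
  [set b | forall g h, b (g * h)%g = b g + pi g (b h)].

Definition coboundary : set {ptws G -> H} :=
  [set b | exists x : H, forall g, b g = pi g x - x].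

(* {ptws G -> H} carries the topology of pointwise convergence, G being
   discrete and H having its norm topology. *)
Definition closed_coboundary : set {ptws G -> H} :=
  cocycle `&` closure coboundary.

(* The quotient Z^1(G, pi) / closure of B^1(G, pi), as the set of cosets. *)
Definition reduced_cohomology : set (set {ptws G -> H}) :=
  [set [set (fun g => b g + c g) | c in closed_coboundary] | b in cocycle].

Definition reduced_cohomology_vanishes : Prop :=
  reduced_cohomology = [set closed_coboundary].

Definition harmonic (mu : {fsfun G -> R with 0}) (b : G -> H) : Prop :=
  \sum_(s <- finsupp mu) (mu s)%:C *: b s = 0.

Definition ker_cocycle (b : G -> H) : set G := [set g | b g = 0].

Definition ker_on_image (b : G -> H) : set G :=
  [set g | forall h, pi g (b h) = b h].

End Representations.

(* Main.v *)
Require Import Defs.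
From HB Require Import structures.
From mathcomp Require Import all_boot all_order all_algebra finmap.
From mathcomp Require Import all_classical all_reals topology normedtype.
From mathcomp Require Import complex.
From mathcomp Require Import ring lra.

(** Let b be a mu-harmonic cocycle and C a finite conjugacy class. The cocycle
    relation gives pi(g) b(g^-1 c g) = b(c) + pi(c) b(g) - b(g), so averaging
    over mu shows that the vector (b(c))_(c in C) of the direct sum H^C is the
    mu-average of its images under a unitary representation of G permuting the
    coordinates. By strict convexity it is invariant:
    pi(g) b(g^-1 c g) = b(c). Hence the b(c) span a finite-dimensional
    subrepresentation (a trivial one if C is a single central element), and
    they vanish; then pi(c) b(g) = b(g).

    For the cohomology, minimizing the mu-energy of b over its translates by
    coboundaries gives a harmonic cocycle that differs from b by a pointwise
    limit of coboundaries; if every harmonic cocycle takes its values in the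
    invariant vectors of a subgroup acting ergodically, it is zero. *)

Set Implicit Arguments.
Unset Strict Implicit.
Unset Printing Implicit Defensive.

Import Order.TTheory GRing.Theory Num.Theory.
Import numFieldNormedType.Exports.

Local Open Scope classical_set_scope.
Local Open Scope ring_scope.

(** * The real inner product of a complex Hilbert space *)

Section RealInner.
Variables (R : realType) (H : hilbertType R).
Implicit Types x y z : H.
Local Open Scope complex_scope.

(** Convexity arguments only need the real part: a symmetric real bilinear form with the same
    norm. *)
Definition rdot x y : R := complex.Re (inner x y).

Lemma rdotDl x y z : rdot (x + y) z = rdot x z + rdot y z.
Proof.
have ReD (a b : R[i]) : complex.Re (a + b) = complex.Re a + complex.Re b.
  by case: a b => [? ?] [].
by rewrite /rdot linearDl; exact: ReD.
Qed.

Lemma rdotC x y : rdot x y = rdot y x.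
Proof.
have ReJ (a : R[i]) : complex.Re (Num.conj a) = complex.Re a by case: a.
by rewrite /rdot hermC expr0 mul1r; exact: ReJ.
Qed.

Lemma rdotDr x y z : rdot x (y + z) = rdot x y + rdot x z.
Proof. by rewrite rdotC rdotDl !(rdotC x). Qed.

Lemma rdotZl (a : R) x y : rdot (a%:C *: x) y = a * rdot x y.
Proof.
have ReZ (u : R[i]) : complex.Re (a%:C * u) = a * complex.Re u.
  by case: u => v w /=; rewrite mul0r subr0.
by rewrite /rdot linearZl_LR; exact: ReZ.
Qed.

Lemma rdotZr (a : R) x y : rdot x (a%:C *: y) = a * rdot x y.
Proof. by rewrite rdotC rdotZl rdotC. Qed.

Lemma rdotNl x y : rdot (- x) y = - rdot x y.
Proof.
by rewrite -scaleN1r -[-1 : R[i]](rmorphN1 (real_complex R)) rdotZl mulN1r.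
Qed.

Lemma rdotNr x y : rdot x (- y) = - rdot x y.
Proof. by rewrite rdotC rdotNl rdotC. Qed.

Lemma rdot0l y : rdot 0 y = 0.
Proof. by rewrite -(subrr 0) rdotDl rdotNl subrr. Qed.

Lemma rdot_suml (I : Type) (r : seq I) (F : I -> H) y :
  rdot (\sum_(i <- r) F i) y = \sum_(i <- r) rdot (F i) y.
Proof.
apply: (big_morph (rdot^~ y)) => [u v|]; [exact: rdotDl | exact: rdot0l].
Qed.

Lemma rdotxx x : (rdot x x)%:C = `|x| ^+ 2.
Proof.
rewrite inner_norm /rdot; have : 0 <= inner x x by exact: dnorm_ge0.
by rewrite lecE /=; case: (inner x x) => u v /= /andP[/eqP ->].
Qed.

Lemma rdot_ge0 x : 0 <= rdot x x.
Proof. by rewrite -lecR rdotxx exprn_ge0. Qed.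

Lemma rdot_eq0 x : rdot x x = 0 -> x = 0.
Proof.
move=> x0; apply/eqP; rewrite -normr_eq0 -sqrf_eq0 -rdotxx x0 //.
Qed.

Lemma rdotBB x y : rdot (x - y) (x - y) = rdot x x - 2 * rdot x y + rdot y y.
Proof.
by rewrite !(rdotDl, rdotDr, rdotNl, rdotNr) (rdotC y x); ring.
Qed.

End RealInner.

(** * Induction over a generating set *)

Section Generation.
Variable G : groupType.

Lemma generated_sub (S K : set G) :
  subgroup K -> S `<=` K -> generated S `<=` K.
Proof. by move=> sK SK x; apply; split. Qed.

Lemma subgroup_intro (K : set G) : K 1%g ->
  (forall x y, K x -> K y -> K (x * y)%g) ->
  (forall x, K x -> K x^-1%g) -> subgroup K.
Proof.
move=> K1 KM KV; split; first by rewrite inE.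
by move=> x y /[!inE] Kx Ky; apply/KM => //; exact: KV.
Qed.

Lemma generated_ind (S K : set G) : generated S = setT -> S `<=` K ->
  K 1%g -> (forall x y, K x -> K y -> K (x * y)%g) ->
  (forall x, K x -> K x^-1%g) -> forall g, K g.
Proof.
move=> genS SK K1 KM KV g.
by apply: (generated_sub (subgroup_intro K1 KM KV) SK); rewrite genS.
Qed.

End Generation.

(** * Harmonic cocycles on finite conjugacy classes *)

Section Cocycle.
Variables (R : realType) (G : groupType) (H : hilbertType R).
Variable pi : unitary_rep G H.
Implicit Types (g h : G) (b : G -> H).
Local Open Scope complex_scope.

Lemma rdot_rep g x y : rdot (pi g x) (pi g y) = rdot x y.
Proof. by rewrite /rdot rep_inner. Qed.

Lemma repKV g x : pi g^-1%g (pi g x) = x.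
Proof. by rewrite -repM mulVg rep1. Qed.

Lemma repVK g x : pi g (pi g^-1%g x) = x.
Proof. by rewrite -repM mulgV rep1. Qed.

Lemma cocycle1 b : cocycle pi b -> b 1%g = 0.
Proof.
move=> bZ; have := bZ 1%g 1%g; rewrite mulg1 rep1 => /eqP.
by rewrite -subr_eq subrr => /eqP.
Qed.

Lemma cocycleV b g : cocycle pi b -> b g^-1%g = - pi g^-1%g (b g).
Proof.
by move=> bZ; apply/eqP; rewrite -addr_eq0 -bZ mulVg cocycle1.
Qed.

(** The cocycle relation expands both sides of [c * g = g * c ^ g]. *)
Lemma cocycle_conj b g c : cocycle pi b ->
  pi g (b (c ^ g)%g) = b c + pi c (b g) - b g.
Proof.
by move=> bZ; rewrite -bZ conjgC bZ addrC addKr.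
Qed.

(** By [cocycle_conj] only [b c] survives: harmonicity kills the averages of [b s] and of
    [pi c (b s)]. *)
Lemma harmonic_conj_mean (mu : {fsfun G -> R with 0}) b c :
  symmetric_generating mu -> cocycle pi b -> harmonic mu b ->
  \sum_(s <- finsupp mu) (mu s)%:C *: pi s (b (c ^ s)%g) = b c.
Proof.
move=> [_ mu1 _ _] bZ hb.
under eq_bigr do rewrite cocycle_conj // 2!scalerDr scalerN.
rewrite sumrB big_split /= hb subr0 -scaler_suml -rmorph_sum /= mu1 scale1r.
under eq_bigr do rewrite -linearZ_LR.
by rewrite -linear_sum hb linear0 addr0.
Qed.

(* Strict convexity in the sum of copies of H indexed by the conjugacy class of
   z: the vector (b c)_c is the mu-average of its images under the unitary maps
   (x_c)_c |-> (pi s x_(c ^ s))_c, hence fixed by each of them. *)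
Lemma harmonic_FC_conj (mu : {fsfun G -> R with 0}) b z :
  symmetric_generating mu -> cocycle pi b -> harmonic mu b ->
  FC_centre G z -> forall g, pi g (b (z ^ g)%g) = b z.
Proof.
move=> mugen bZ hb /finite_fsetP [C defC].
have Cz c : c \in C -> exists h, (z ^ h)%g = c.
  move=> cC; have : range (conjg z) c by rewrite defC.
  by case=> h _ <-; exists h.
have CJ c g : c \in C -> (c ^ g)%g \in C.
  move=> /Cz [h <-]; have : range (conjg z) ((z ^ h) ^ g)%g.
    by exists (h * g)%g => //; rewrite conjgM.
  by rewrite defC.
have zC : z \in C.
  have : range (conjg z) z by exists 1%g => //; rewrite conjg1.
  by rewrite defC.
have sumJ (F : G -> R) g : \sum_(c <- C) F (c ^ g)%g = \sum_(c <- C) F c.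
  rewrite -(big_map (conjg^~ g) predT F); apply: perm_big.
  apply: uniq_perm; rewrite ?fset_uniq //.
    by rewrite map_inj_uniq ?fset_uniq // => x y; exact: conjg_inj.
  move=> c; apply/mapP/idP => [[d dC ->]|cC]; first exact: CJ.
  by exists (c ^ g^-1)%g; [exact: CJ | rewrite conjgKV].
have [mu0 mu1 _ gen] := mugen.
pose D s := \sum_(c <- C)
  rdot (pi s (b (c ^ s)%g) - b c) (pi s (b (c ^ s)%g) - b c).
have D0 s : 0 <= D s by apply: sumr_ge0 => c _; exact: rdot_ge0.
pose N := \sum_(c <- C) rdot (b c) (b c).
(* Both squared norms sum to [N], since [pi s] is unitary and conjugation by [s] permutes [C]. *)
have DE s : D s = N *+ 2 - 2 * \sum_(c <- C) rdot (pi s (b (c ^ s)%g)) (b c).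
  rewrite /D; under eq_bigr do rewrite rdotBB rdot_rep.
  rewrite big_split sumrB /= (sumJ (fun c => rdot (b c) (b c))) -mulr_sumr.
  by rewrite mulr2n addrAC.
have muD : \sum_(s <- finsupp mu) mu s * D s = 0.
  under eq_bigr do rewrite DE mulrBr mulrCA.
  rewrite sumrB -mulr_suml mu1 mul1r -mulr_sumr.
  under [X in _ - _ * X]eq_bigr do rewrite mulr_sumr.
  rewrite exchange_big /=.
  (* The cross terms average to [N]: pair [harmonic_conj_mean] with [b c]. *)
  suff -> : \sum_(c <- C) \sum_(s <- finsupp mu)
      mu s * rdot (pi s (b (c ^ s)%g)) (b c) = N by rewrite mulr_natl subrr.
  apply: eq_bigr => c _.
  rewrite -[RHS](congr1 (fun x => rdot x (b c))
    (harmonic_conj_mean c mugen bZ hb)).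
  by rewrite rdot_suml; apply: eq_bigr => s _; rewrite rdotZl.
(* The induction needs all of [C] at once, because the product and inverse steps move [c] within its
   class. *)
suff: forall g c, c \in C -> pi g (b (c ^ g)%g) = b c by move=> + g; apply.
apply: (generated_ind gen).
- move=> s smu c cC; apply/eqP; rewrite -subr_eq0; apply/eqP/rdot_eq0.
  have Ds : D s = 0.
    have := muD; move/eqP; rewrite psumr_eq0; last first.
      by move=> t _; rewrite mulr_ge0.
    move/allP => /(_ s smu) /=; rewrite mulf_eq0 => /orP[|/eqP//].
    by move: smu; rewrite /= mem_finsupp => /negPf ->.
  move/eqP: Ds; rewrite psumr_eq0; last by move=> d _; exact: rdot_ge0.
  by move/allP => /(_ c cC) /eqP.
- by move=> c _; rewrite conjg1 rep1.
- by move=> g h Kg Kh c cC; rewrite conjgM repM Kh ?CJ // Kg.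
- move=> g Kg c cC; rewrite -(Kg (c ^ g^-1)%g) ?CJ //.
  by rewrite repKV conjgKV.
Qed.

(** Under these hypotheses [cocycle_conj] reduces to [0 = pi z (b h) - b h]. *)
Lemma FC_kernel b z : cocycle pi b ->
  (forall g, pi g (b (z ^ g)%g) = b z) -> b z = 0 ->
  (ker_cocycle b `&` ker_on_image pi b) z.
Proof.
move=> bZ bJ bz0; split=> // h.
move/eqP: (cocycle_conj h z bZ); rewrite bJ bz0 add0r eq_sym subr_eq0.
by move/eqP.
Qed.

End Cocycle.

(** * Vanishing on the FC-centre and on the centre *)

Section FC.
Variables (R : realType) (G : groupType) (H : hilbertType R).
Variable pi : unitary_rep G H.
Implicit Types (g h z : G) (b : G -> H).

Lemma weakly_mixing_FC_eq0 b z : weakly_mixing pi -> FC_centre G z ->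
  (forall g, pi g (b (z ^ g)%g) = b z) -> b z = 0.
Proof.
move=> wm /finite_fsetP [C defC] bJ.
(* The values of [b] on the class of [z] thus form the orbit of [b z], so their span [V] is
   invariant. *)
have bE h : b (z ^ h)%g = pi h^-1%g (b z) by rewrite -(bJ h) repKV.
pose e (i : 'I_(size C)) := b (nth z C i).
pose V := range (fun a : 'I_(size C) -> R[i] => \sum_(i < size C) a i *: e i).
have V0 : V 0.
  by exists (fun=> 0) => //; rewrite big1 // => i _; rewrite scale0r.
have VD u v : V u -> V v -> V (u + v).
  move=> [a _ <-] [a' _ <-]; exists (fun i => a i + a' i) => //.
  by rewrite -big_split; apply: eq_bigr => i _; rewrite scalerDl.
have VZ k u : V u -> V (k *: u).
  move=> [a _ <-]; exists (fun i => k * a i) => //.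
  by rewrite scaler_sumr; apply: eq_bigr => i _; rewrite scalerA.
have VJ h : V (b (z ^ h)%g).
  have zhC : (z ^ h)%g \in C.
    have : range (conjg z) (z ^ h)%g by exists h.
    by rewrite defC.
  have ltC : (index (z ^ h)%g C < size C)%N by rewrite index_mem.
  exists (fun i => (i == Ordinal ltC)%:R) => //.
  rewrite (bigD1 (Ordinal ltC)) //= eqxx scale1r big1 ?addr0 /e ?nth_index //.
  by move=> i /negPf ->; rewrite scale0r.
suff : V = [set 0] by move=> VE; have := VJ 1%g; rewrite conjg1 VE.
apply: wm; last by exists (size C), e.
split; first split.
- by rewrite inE.
- by move=> a u v /[!inE] Vu Vv; apply: VD => //; exact: VZ.
- move=> g _ [a _ <-]; rewrite linear_sum /=.
  apply: (big_ind V) => // i _; rewrite linearZ_LR; apply: VZ.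
  have : range (conjg z) (nth z C i) by rewrite defC /=; exact: mem_nth.
  move=> [h _]; rewrite /e => <-.
  have -> : pi g (b (z ^ h)%g) = b (z ^ (h * g^-1))%g.
    by rewrite !bE -repM invgM invgK.
  exact: VJ.
Qed.

Lemma weakly_mixing_kernel (mu : {fsfun G -> R with 0}) b :
  weakly_mixing pi -> symmetric_generating mu -> cocycle pi b ->
  harmonic mu b -> FC_centre G `<=` ker_cocycle b `&` ker_on_image pi b.
Proof.
move=> wm mugen bZ hb z zFC.
have bJ := harmonic_FC_conj mugen bZ hb zFC.
by apply: FC_kernel => //; exact: weakly_mixing_FC_eq0.
Qed.

(** The class of a central [z] is a singleton, so [b z] is fixed by all of [G]. *)
Lemma ergodic_kernel (mu : {fsfun G -> R with 0}) b :
  ergodic pi -> symmetric_generating mu -> cocycle pi b ->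
  harmonic mu b -> centre G `<=` ker_cocycle b `&` ker_on_image pi b.
Proof.
move=> erg mugen bZ hb z zZ.
have zJ g : (z ^ g)%g = z by rewrite /conjg zZ mulKg.
have zFC : FC_centre G z.
  apply: (@sub_finite_set _ _ [set z]) => [_ [g _ <-]|]; first by rewrite zJ.
  exact: finite_set1.
have bJ := harmonic_FC_conj mugen bZ hb zFC.
apply: FC_kernel => //; apply: erg => g _.
by rewrite -[in LHS](zJ g) bJ.
Qed.

End FC.

(** * Convergence through squared norms *)

Section Convergence.
Variables (R : realType) (H : hilbertType R).
Implicit Types (u : nat -> H).
Local Open Scope complex_scope.

Lemma norm_lt_rdot (x : H) (e : R) : 0 < e -> rdot x x < e ^+ 2 -> `|x| < e%:C.
Proof.
move=> e0 xe; rewrite -ltr_sqr ?nnegrE ?ler0c ?normr_ge0 ?ltW ?ltcR //.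
by rewrite -rdotxx -rmorphXn ltcR.
Qed.

(** Norms on [H] take values in [R[i]], so the epsilons of its topology are complex; positivity
    makes them real. *)
Lemma gt0_complexP (e : R[i]) : 0 < e -> exists2 r : R, 0 < r & e = r%:C.
Proof.
rewrite ltcE /= => /andP[/eqP e0 r0]; exists (complex.Re e) => //.
by case: e e0 r0 => x y /= ->.
Qed.

Lemma rdot_cvg0 u :
  (forall e : R, 0 < e -> exists N, forall n, (N <= n)%N ->
     rdot (u n) (u n) < e) ->
  u @ \oo --> (0 : H).
Proof.
move=> ucvg; apply/cvgr0Pnorm_lt => _ /gt0_complexP [e e0 ->].
have [N Nu] := ucvg (e ^+ 2) (exprn_gt0 _ e0).
by exists N => // n /Nu; exact: norm_lt_rdot.
Qed.

Lemma rdot_cauchy u :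
  (forall e : R, 0 < e -> exists N, forall n, (N <= n)%N ->
     rdot (u N - u n) (u N - u n) < e) ->
  cvg (u @ \oo).
Proof.
move=> uC; apply: cauchy_cvg; apply: cauchy_exP => _ /gt0_complexP [e e0 ->].
have [N Nu] := uC (e ^+ 2) (exprn_gt0 _ e0).
exists (u N); exists N => // n /Nu.
by rewrite -ball_normE; exact: norm_lt_rdot.
Qed.

(** The parallelogram identity, with the sum replaced by the midpoint. *)
Lemma rdot_midpoint (x y : H) :
  rdot (x - y) (x - y) = 2 * rdot x x + 2 * rdot y y -
    4 * rdot (2^-1%:C *: (x + y)) (2^-1%:C *: (x + y)).
Proof.
rewrite rdotBB rdotZl rdotZr !(rdotDl, rdotDr) (rdotC y x).
by field.
Qed.

End Convergence.

(** * Energy minimization modulo coboundaries *)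

Section HarmonicPart.
Variables (R : realType) (G : groupType) (H : hilbertType R).
Variable pi : unitary_rep G H.
Implicit Types (g h s : G) (b : G -> H).
Local Open Scope complex_scope.

Lemma norm_rep g x : `|pi g x| = `|x|.
Proof.
by apply/eqP; rewrite -(@eqrXn2 _ 2) ?nnegrE // -!rdotxx rdot_rep.
Qed.

Lemma rep_cvg g (u : nat -> H) l :
  u @ \oo --> l -> pi g (u n) @[n --> \oo] --> pi g l.
Proof.
move=> /cvgrPdist_lt ul; apply/cvgrPdist_lt => e /ul.
by apply: filterS => n; rewrite -linearB norm_rep.
Qed.

(** For a cocycle [b], these run over its cohomology class as [x] varies. *)
Definition defect b x g := b g - (pi g x - x).

Lemma cocycle_defect b x : cocycle pi b -> cocycle pi (defect b x).
Proof.
move=> bZ g h; rewrite /defect bZ repM !linearB /=.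
by rewrite !opprK !addrA [RHS](ACl (1*4*5*3*2*6)) /= addrNK.
Qed.

Section Energy.
Variable mu : {fsfun G -> R with 0}.
Hypothesis mugen : symmetric_generating mu.

Definition energy b := \sum_(s <- finsupp mu) mu s * rdot (b s) (b s).
Definition mean b := \sum_(s <- finsupp mu) (mu s)%:C *: b s.

Lemma energy_ge0 b : 0 <= energy b.
Proof.
have [mu0 _ _ _] := mugen.
by apply: sumr_ge0 => s _; rewrite mulr_ge0 ?rdot_ge0.
Qed.

Lemma sum_inv (F : G -> R) :
  \sum_(s <- finsupp mu) F s^-1%g = \sum_(s <- finsupp mu) F s.
Proof.
have [_ _ muV _] := mugen.
rewrite -(big_map (fun s : G => s^-1%g) predT F); apply: perm_big.
apply: uniq_perm; rewrite ?fset_uniq //.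
  by rewrite map_inj_uniq ?fset_uniq //; exact: invg_inj.
move=> s; apply/mapP/idP => [[t + ->]|sS].
  by rewrite !mem_finsupp muV.
by exists s^-1%g; rewrite ?invgK // mem_finsupp muV -mem_finsupp.
Qed.

(* For symmetric mu, the gradient at 0 of x |-> energy (defect b x) is thus
   4 * mean b: critical means harmonic. *)
Lemma rdot_cocycle_coboundary b x : cocycle pi b ->
  \sum_(s <- finsupp mu) mu s * rdot (b s) (pi s x - x) = - 2 * rdot (mean b) x.
Proof.
move=> bZ; have [_ _ muV _] := mugen.
have meanE : rdot (mean b) x = \sum_(s <- finsupp mu) mu s * rdot (b s) x.
  by rewrite rdot_suml; apply: eq_bigr => s _; rewrite rdotZl.
under eq_bigr do rewrite rdotDr rdotNr mulrDr mulrN.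
(* Under [s |-> s^-1], the term [rdot (b s) (pi s x)] becomes [- rdot (b s) x], by [cocycleV] and
   unitarity. *)
rewrite sumrB -meanE -[X in X - _]sum_inv.
under eq_bigr => s _.
  rewrite muV -(rdot_rep pi s) repVK (cocycleV _ bZ) linearN /= repVK.
  rewrite rdotNl mulrN.
  over.
by rewrite sumrN -meanE; ring.
Qed.

(** A gradient step. Moving by [- t *: v], where [v = mean b], changes the energy by at most
    [(4 t^2 - 4 t) * rdot v v], which is least at [t = 1/2]. *)
Lemma energy_descent b : cocycle pi b ->
  energy (defect b ((- 2^-1)%:C *: mean b)) <=
    energy b - rdot (mean b) (mean b).
Proof.
move=> bZ; have [mu0 mu1 _ _] := mugen.
set v := mean b.
have pt s : rdot (defect b ((- 2^-1)%:C *: v) s) (defect b ((- 2^-1)%:C *: v) s)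
    <= rdot (b s) (b s) + rdot (b s) (pi s v - v) + rdot v v.
  (* This positivity amounts to [rdot (pi s v - v) (pi s v - v) <= 4 * rdot v v]. *)
  have : 0 <= rdot (pi s v + v) (pi s v + v) by exact: rdot_ge0.
  rewrite /defect linearZ_LR -scalerBr.
  rewrite rdotBB rdotZl !rdotZr.
  rewrite [in X in _ -> X]rdotBB !rdotDl !rdotDr !rdot_rep.
  by rewrite rdotNr (rdotC v (pi s v)); lra.
apply: (@le_trans _ _ (\sum_(s <- finsupp mu)
   mu s * (rdot (b s) (b s) + rdot (b s) (pi s v - v) + rdot v v))).
  by apply: ler_sum => s _; apply: ler_wpM2l.
under eq_bigr do rewrite 2!mulrDr.
rewrite 2!big_split /= -mulr_suml mu1 rdot_cocycle_coboundary //.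
by rewrite -/(energy b) -/v; lra.
Qed.

(** As [defect b x] is affine in [x], [rdot_midpoint] applies at each [s]. *)
Lemma energy_midpoint b x y :
  energy (fun s => pi s (x - y) - (x - y)) =
    2 * energy (defect b x) + 2 * energy (defect b y) -
    4 * energy (defect b (2^-1%:C *: (x + y))).
Proof.
rewrite /energy !mulr_sumr -big_split -sumrB /=; apply: eq_bigr => s _.
have -> : pi s (x - y) - (x - y) = defect b y s - defect b x s.
  rewrite /defect linearB !opprD !opprK !addrA.
  by rewrite (ACl ((1*4)*5*2*6*3)) /= subrr add0r.
rewrite rdot_midpoint.
have -> : 2^-1%:C *: (defect b y s + defect b x s) =
    defect b (2^-1%:C *: (x + y)) s.
  rewrite /defect linearZ_LR -scalerBr.
  have {3}-> : b s = 2^-1%:C *: (b s + b s).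
    rewrite -mulr2n -(scaler_nat 2 (b s)) scalerA.
    rewrite -(rmorph_nat (real_complex R)) -rmorphM.
    by rewrite mulVf ?pnatr_eq0 // rmorph1 scale1r.
  rewrite -scalerBr; congr (_ *: _).
  by rewrite (linearD (pi s)) !opprD !opprK !addrA [LHS](ACl (1*4*5*2*6*3)).
by ring.
Qed.

(* A minimizing sequence of x |-> energy (defect b x) is Cauchy by the
   parallelogram identity; since the mean controls the possible decrease of the
   energy, it vanishes in the limit. *)
Lemma harmonic_part b : cocycle pi b ->
  exists (x : nat -> H) (c : G -> H),
    [/\ forall g, pi g (x n) - x n @[n --> \oo] --> c g,
        cocycle pi (fun g => b g - c g) & harmonic mu (fun g => b g - c g)].
Proof.
move=> bZ; have [mu0 mu1 _ gen] := mugen.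
pose A : set R := range (fun x => energy (defect b x)).
have infA : has_inf A.
  split; first by exists (energy (defect b 0)); exists 0.
  by exists 0 => _ [x _ <-]; exact: energy_ge0.
have leA x : inf A <= energy (defect b x).
  by apply: ge_inf; [case: infA | exists x].
have /choice [x xP] : forall n : nat, exists x,
    energy (defect b x) < inf A + n.+1%:R^-1.
  move=> n; have n0 : 0 < n.+1%:R^-1 :> R by rewrite invr_gt0.
  by have [_ [x _ <-] ?] := inf_adherent n0 infA; exists x.
have small (e : R) : 0 < e ->
    exists N : nat, forall n, (N <= n)%N -> n.+1%:R^-1 < e.
  move=> e0; exists (Num.bound e^-1) => n len.
  rewrite invf_plt ?posrE //.
  have : e^-1 < (Num.bound e^-1)%:R.
    by apply: archi_boundP; rewrite invr_ge0 ltW.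
  by move/lt_le_trans; apply; rewrite ler_nat ltnW.
(* The energy controls only [s] in the support; products and inverses follow from the cocycle
   relation for coboundaries. *)
have xC g : cvg (pi g (x n) - x n @[n --> \oo]).
  move: g; apply: (generated_ind gen).
  - move=> s /= smu; apply: rdot_cauchy => e e0.
    have mus : 0 < mu s.
      by rewrite lt_neqAle mu0 andbT eq_sym; rewrite mem_finsupp in smu.
    (* Midpoints have energy at least [inf A], so the energy of the difference is below
       [2 / (N + 1) + 2 / (n + 1)], hence below [mu s * e]. *)
    have mue : 0 < mu s * e / 4 by rewrite divr_gt0 ?mulr_gt0.
    have [N NP] := small _ mue.
    exists N => n leNn.
    have -> : pi s (x N) - x N - (pi s (x n) - x n) =
        pi s (x N - x n) - (x N - x n).
      by rewrite (linearB (pi s)) !opprD !opprK !addrA [LHS](ACl (1*3*2*4)).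
    rewrite -(ltr_pM2l mus).
    apply: (@le_lt_trans _ _
      (energy (fun s => pi s (x N - x n) - (x N - x n)))).
      rewrite /energy (big_fsetD1 s) //= lerDl.
      by apply: sumr_ge0 => t _; rewrite mulr_ge0 ?rdot_ge0.
    rewrite (energy_midpoint b).
    have := leA (2^-1%:C *: (x N + x n)).
    have := NP N (leqnn _); have := NP n leNn; have := xP n; have := xP N.

    by move: N.+1%:R^-1 n.+1%:R^-1 => ? ?; lra.
  - have -> : (fun n => pi 1%g (x n) - x n) = (fun=> 0).
      by apply/funext => n; rewrite rep1 subrr.
    exact: is_cvg_cst.
  - move=> g h Kg Kh.
    have -> : (fun n => pi (g * h)%g (x n) - x n) =
       (fun n => pi g (pi h (x n) - x n) + (pi g (x n) - x n)).
      by apply/funext => n; rewrite repM linearB /= addrA subrK.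
    apply: is_cvgD => //.
    apply/cvg_ex; exists (pi g (lim (pi h (x n) - x n @[n --> \oo]))).
    by apply: rep_cvg.
  - move=> g Kg.
    have -> : (fun n => pi g^-1%g (x n) - x n) =
       (fun n => - pi g^-1%g (pi g (x n) - x n)).
      by apply/funext => n; rewrite linearB /= repKV opprB.
    apply: is_cvgN.
    apply/cvg_ex; exists (pi g^-1%g (lim (pi g (x n) - x n @[n --> \oo]))).
    by apply: rep_cvg.
pose c g := lim (pi g (x n) - x n @[n --> \oo]).
exists x, c; split=> //.
- have cM g h : c (g * h)%g = c g + pi g (c h).
    apply: (cvg_lim (@norm_hausdorff _ H)).
    have -> : (fun n => pi (g * h)%g (x n) - x n) =
       (fun n => (pi g (x n) - x n) + pi g (pi h (x n) - x n)).
      by apply/funext => n; rewrite repM linearB [RHS]addrC addrA subrK.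
    by apply: cvgD => //; exact: rep_cvg.
  move=> g h /=; rewrite bZ cM linearB /=.
  by rewrite opprD !addrA; rewrite [LHS](ACl (1*3*2*4))/=.
(* A gradient step from [x n] cannot go below [inf A], so the squared norm of the mean is less than
   [1 / (n + 1)]. *)
- have to0 : mean (defect b (x n)) @[n --> \oo] --> (0 : H).
    apply: rdot_cvg0 => e e0; have [N NP] := small e e0.
    exists N => n /NP; apply: le_lt_trans.
    have := energy_descent (cocycle_defect (x n) bZ).
    set w := (_ *: _).
    have -> : defect (defect b (x n)) w = defect b (x n + w).
      apply/funext => g; rewrite /defect (linearD (pi g)) !opprD !opprK !addrA.
      by rewrite [LHS](ACl (1*2*4*3*5)).
    have := leA (x n + w); have := xP n.
    by move: n.+1%:R^-1 => ?; lra.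
  have toc : mean (defect b (x n)) @[n --> \oo] --> mean (fun g => b g - c g).
    apply: (cvg_big add_continuous) => s _.
    apply: cvgZl_tmp; apply: cvgB => //; exact: cvg_cst.
  exact: (cvg_unique (@norm_hausdorff _ H) toc to0).
Qed.

End Energy.
End HarmonicPart.

(** * Existence of a symmetric generating measure *)

Lemma ex_symmetric_generating (R : realType) (G : groupType) :
  finitely_generated G ->
  exists mu : {fsfun G -> R with 0}, symmetric_generating mu.
Proof.
move=> [S /finite_fsetP [F ->] genF].
(* The measure is uniform on [T]; adjoining [1] keeps [T] non-empty even when [F] is empty. *)
pose T := (1%g |` (F `|` [fset s^-1%g | s in F]))%fset.
have T0 : (0 < #|` T|)%N.
  by rewrite cardfs_gt0; apply/fset0Pn; exists 1%g; rewrite !inE eqxx.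
have TV s : s \in T -> s^-1%g \in T.
  rewrite !inE => /or3P [/eqP ->|sF|/imfsetP [t /= tF ->]].
  - by rewrite invg1 eqxx.
  - by rewrite in_imfset ?orbT.
  - by rewrite invgK tF orbT.
pose w : R := (#|` T|%:R)^-1.
have w0 : 0 < w by rewrite invr_gt0 ltr0n.
pose mu : {fsfun G -> R with 0} := [fsfun s in T => w | 0].
have muE s : mu s = if s \in T then w else 0 by rewrite fsfun_fun.
have supp : finsupp mu = T.
  apply/fsetP => s; rewrite mem_finsupp muE.
  by case: ifP; rewrite ?eqxx ?gt_eqF.
exists mu; split.
- by move=> s; rewrite muE; case: ifP => // _; exact: ltW.
- rewrite supp (eq_big_seq (fun=> w)) => [|s sT]; last by rewrite muE sT.
  rewrite big_const_seq count_predT iter_addr_0 -mulr_natl divff //.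
  by rewrite pnatr_eq0 -lt0n.
- move=> s; rewrite !muE; congr (if _ then _ else _).
  by apply/idP/idP => /TV //; rewrite invgK.
- rewrite supp -subTset -genF => x Fx K [sK TK].
  apply: (generated_sub sK _ Fx) => s sF; apply: TK => /=.
  by rewrite !inE (_ : s \in F) ?orbT.
Qed.

(** * Vanishing of reduced cohomology *)

Section Vanishing.
Variables (R : realType) (G : groupType) (H : hilbertType R).
Variable pi : unitary_rep G H.
Implicit Types (b : G -> H) (K : set G).

(** Every cocycle then lies in [closed_coboundary], so there is a single coset. *)
Lemma reduced_cohomology_vanishesP :
  cocycle pi `<=` closure (coboundary pi) -> reduced_cohomology_vanishes pi.
Proof.
move=> ZB; have E : closed_coboundary pi = cocycle pi.
  by rewrite /closed_coboundary setIidl.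
rewrite /reduced_cohomology_vanishes /reduced_cohomology E.
have coset b : cocycle pi b ->
    [set (fun g => b g + c g) | c in cocycle pi] = cocycle pi.
  move=> bZ; apply/seteqP; split=> [_ [c cZ <-] g h|c cZ].
    by rewrite bZ cZ linearD addrACA.
  exists (fun g => c g - b g); last by apply/funext => g; rewrite addrC subrK.
  by move=> g h; rewrite bZ cZ linearB opprD addrACA.
apply/seteqP; split=> [_ [b bZ <-]|_ ->]; first exact: coset.
exists (fun=> 0); last by apply: coset => g h; rewrite linear0 addr0.
by move=> g h; rewrite linear0 addr0.
Qed.

Lemma vanishing_of_harmonic (mu : {fsfun G -> R with 0}) :
  symmetric_generating mu ->
  (forall b, cocycle pi b -> harmonic mu b -> forall g, b g = 0) ->
  reduced_cohomology_vanishes pi.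
Proof.
move=> mugen h0; apply: reduced_cohomology_vanishesP => b bZ.
have [x [c [xc bcZ hbc]]] := harmonic_part mugen bZ.
(* The harmonic cocycle [b - c] is zero, which makes [b] itself a pointwise limit of
   coboundaries. *)
have bE : b = c.
  apply/funext => g; apply/eqP; rewrite -subr_eq0; apply/eqP.
  exact: h0 hbc g.
rewrite closureEcvg /=.
exists ((fun n g => pi g (x n) - x n) @ \oo); first exact: fmap_proper_filter.
split.
  by apply/(@pointwise_cvgP (discrete_topology G) H) => g; rewrite bE;
    exact: xc.
move=> A BA; exists 0%N => // n _; apply: BA.
by exists (x n).
Qed.

Lemma ergodic_on_eq0 K b : ergodic_on pi K ->
  K `<=` ker_on_image pi b -> forall g, b g = 0.
Proof. by move=> ergK Kb g; apply: ergK => z /Kb; apply. Qed.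

End Vanishing.

Theorem theorem1p1 (R : realType) (G : groupType) (H : hilbertType R)
    (pi : unitary_rep G H) (fgG : finitely_generated G) :
  [/\ weakly_mixing pi ->
        forall mu : {fsfun G -> R with 0}, symmetric_generating mu ->
        forall b : G -> H, cocycle pi b -> harmonic mu b ->
        FC_centre G `<=` ker_cocycle b `&` ker_on_image pi b,
      ergodic pi ->
        forall mu : {fsfun G -> R with 0}, symmetric_generating mu ->
        liouville mu ->
        forall b : G -> H, cocycle pi b -> harmonic mu b ->
        centre G `<=` ker_cocycle b `&` ker_on_image pi b,
      weakly_mixing pi ->
        (exists K : set G, [/\ subgroup K, K <> [set 1%g],
           K `<=` FC_centre G & ergodic_on pi K]) ->
        reduced_cohomology_vanishes pi
    & ergodic pi ->
        (exists mu : {fsfun G -> R with 0},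
           symmetric_generating mu /\ liouville mu) ->
        (exists K : set G, [/\ subgroup K, K <> [set 1%g],
           K `<=` centre G & ergodic_on pi K]) ->
        reduced_cohomology_vanishes pi].
Proof.
split.
- by move=> wm mu mugen b bZ hb; exact: (weakly_mixing_kernel wm mugen bZ hb).
- by move=> erg mu mugen _ b bZ hb; exact: (ergodic_kernel erg mugen bZ hb).
- move=> wm [K [_ _ KFC ergK]].
  (* This claim prescribes no measure; finite generation supplies one. *)
  have [mu mugen] := ex_symmetric_generating R fgG.
  apply: (vanishing_of_harmonic mugen) => b bZ hb.
  apply: ergodic_on_eq0 ergK _ => z /KFC.
  by case/(weakly_mixing_kernel wm mugen bZ hb).
- move=> erg [mu [mugen _]] [K [_ _ KZ ergK]].
  apply: (vanishing_of_harmonic mugen) => b bZ hb.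
  apply: ergodic_on_eq0 ergK _ => z /KZ.
  by case/(ergodic_kernel erg mugen bZ hb).
Qed.
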